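(* Let $\mathcal{H}$ be a real Hilbert space, let $A, B: \mathcal{H} \rightrightarrows \mathcal{H}$ be maximally monotone operators, let $D: \mathcal{H} \to \mathcal{H}$ be an $\eta$-cocoercive operator with $\eta > 0$, and suppose that $C := \operatorname{zer} B \neq \emptyset$. Let $(\lambda_n)_{n \in \mathbb{N}}$ and $(\beta_n)_{n\in\mathbb{N}}$ be sequences of positive real numbers. Assume that: (i) $A + N_C$ is maximally monotone and $\operatorname{zer}(A + D + N_C) \neq \emptyset$; (ii) for every $p \in \operatorname{Ran} N_C$, $\displaystyle\sum_{n \in \mathbb{N}} \lambda_n \beta_n \left( \sup_{\tilde u \in C} \varphi_B\left(\tilde u, \frac{p}{\beta_n}\right) - \sigma_C\left(\frac{p}{\beta_n}\right) \right) < +\infty$; (iii) $(\lambda_n)_{n\in\mathbb{N}} \in \ell^2 \setminus \ell^1$. Let $x_0 \in \mathcal{H}$ be arbitrary and let $(x_n)_{n \geq 0}$ and $(w_n)_{n\in\mathbb{N}}$ be generated, for all $n \geq 1$, by $$y_{n-1} = x_{n-1} - \lambda_n D x_{n-1}, \qquad w_n = J_{\lambda_n A}\, y_{n-1}, \qquad x_n = J_{\lambda_n \beta_n B}\, w_n.$$ If the operator $A$ is $\gamma$-strongly monotone with $\gamma > 0$, then $(x_n)_{n\ge 0}$ converges strongly to the unique element of $\operatorname{zer}(A+D+N_C)$ as $n \to +\infty$.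
   Context: $\mathbb{N} = \{1,2,\ldots\}$. For a set-valued operator $M:\mathcal{H} \rightrightarrows \mathcal{H}$: $\operatorname{Graph} M = \{(x,u) : u \in Mx\}$, $\operatorname{Ran} M = \bigcup_{x\in\mathcal{H}} Mx$, $\operatorname{zer} M = \{x : 0 \in Mx\}$. $M$ is monotone if $\langle x-y, u-v\rangle \ge 0$ for all $(x,u),(y,v)\in\operatorname{Graph} M$, and maximally monotone if moreover its graph has no proper monotone extension in $\mathcal{H}\times\mathcal{H}$. $M$ is $\gamma$-strongly monotone if $\langle x-y,u-v\rangle\ge\gamma\|x-y\|^2$ for all $(x,u),(y,v)\in\operatorname{Graph} M$. The resolvent is $J_M = (\operatorname{Id}+M)^{-1}$, which is single-valued with full domain when $M$ is maximally monotone. A single-valued $D:\mathcal{H}\to\mathcal{H}$ is $\eta$-cocoercive if $\langle x-y, Dx-Dy\rangle \ge \eta\|Dx-Dy\|^2$ for all $x,y\in\mathcal{H}$. The normal cone is $N_C(x)=\{u : \langle u,y-x\rangle\le 0 \text{ for all } y\in C\}$ if $x\in C$ and $N_C(x)=\emptyset$ otherwise; the support function is $\sigma_C(u)=\sup_{y\in C}\langle u,y\rangle$. The Fitzpatrick function of $B$ is $\varphi_B(x,u)=\sup\{\langle x,v\rangle+\langle y,u\rangle-\langle y,v\rangle : (y,v)\in\operatorname{Graph} B\}$, with values in $\mathbb{R}\cup\{\pm\infty\}$. *)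

(* Defs.v *)
From mathcomp Require Import all_boot all_order all_algebra.
From mathcomp Require Import all_classical all_reals all_analysis.

Set Implicit Arguments.
Unset Strict Implicit.
Unset Printing Implicit Defensive.

Import Order.TTheory GRing.Theory Num.Theory.
Import numFieldNormedType.Exports.

Local Open Scope classical_set_scope.
Local Open Scope ring_scope.

(* A set-valued operator H => H is a function H -> set H.
   A real Hilbert space is a completeNormedModType H over R together with a
   positive definite symmetric form ip : {dot H for idfun} such that
   induces_norm ip. *)

Section SetValuedOperators.
Context {R : realType} {H : lmodType R}.
Implicit Types M N : H -> set H.

Definition graph M : set (H * H) := [set z | M z.1 z.2].

Definition ran M : set H := \bigcup_x M x.

Definition zer M : set H := [set x | M x 0].

Definition single (f : H -> H) : H -> set H := fun x => [set f x].

Definition op_add M N : H -> set H :=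
  fun x => [set u + v | u in M x & v in N x].

Definition op_scale (a : R) M : H -> set H := fun x => [set a *: u | u in M x].

Definition op_inv M : H -> set H := fun u => [set x | M x u].

(* Set-valued, defined for every M: for M maximally monotone its values are
   singletons, and then [p = J_M x] reads [resolvent M x p]. *)
Definition resolvent M : H -> set H := op_inv (op_add (single idfun) M).

End SetValuedOperators.

Section Monotonicity.
Context {R : realType} {H : completeNormedModType R}.
Variable ip : {dot H for idfun}.
Implicit Types M N : H -> set H.

Definition induces_norm := forall x : H, ip x x = `|x| ^+ 2.

Definition monotone M := forall x u y v,
  graph M (x, u) -> graph M (y, v) -> 0 <= ip (x - y) (u - v).

Definition maximally_monotone M := monotone M /\
  forall N, monotone N -> graph M `<=` graph N -> graph N = graph M.

Definition strongly_monotone (gamma : R) M := forall x u y v,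
  graph M (x, u) -> graph M (y, v) ->
  gamma * `|x - y| ^+ 2 <= ip (x - y) (u - v).

Definition cocoercive (eta : R) (D : H -> H) := forall x y,
  eta * `|D x - D y| ^+ 2 <= ip (x - y) (D x - D y).

Definition normal_cone (C : set H) : H -> set H :=
  fun x => [set u | C x /\ forall y, C y -> ip u (y - x) <= 0].

Definition support_fun (C : set H) (u : H) : \bar R :=
  ereal_sup [set (ip u y)%:E | y in C].

Definition fitzpatrick M (x u : H) : \bar R :=
  ereal_sup [set (ip x z.2 + ip z.1 u - ip z.1 z.2)%:E | z in graph M].

End Monotonicity.

(* The sequence space l^p over the index set {1, 2, ...}: u 0 is irrelevant. *)
Definition ell {R : realType} (p : nat) : set (nat -> R) :=
  [set u | summable [set n | (0 < n)%N] (fun n => (u n ^+ p)%:E)].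

(* Main.v *)
Require Import Defs.
From mathcomp Require Import all_boot all_order all_algebra.
From mathcomp Require Import all_classical all_reals all_analysis.
From mathcomp Require Import ring lra.

Set Implicit Arguments.
Unset Strict Implicit.
Unset Printing Implicit Defensive.

Import Order.TTheory GRing.Theory Num.Theory.
Import numFieldNormedType.Exports.

Local Open Scope classical_set_scope.
Local Open Scope ring_scope.

(** Fix [u] in [zer (A + D + N_C)], so that [a + D u + p = 0] for some [a] in
    [A u] and some [p] normal to [C] at [u], and put [d n = `|x n - u| ^+ 2].
    Strong monotonicity of [A] between [w n] and [u], cocoercivity of [D]
    between [x n.-1] and [u], and the definition of the Fitzpatrick function
    at [u], tested on the point of [graph B] produced by the resolvent of [B],
    add up to (lemma [fb_step])
      [d n + 2 lambda gamma `|w n - u| ^+ 2 <=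
         d n.-1 + 2 lambda beta gap + lambda ^+ 2 `|p| ^+ 2]
    as soon as [lambda <= 2 eta], where [gap] is the difference occurring in
    the summability assumption.  Here [p] enters only through the product of
    [w n - x n] with [p], which is why it costs a multiple of [lambda ^+ 2],
    a summable quantity, and not of [lambda].  The gap is nonnegative because
    [0] belongs to [B u], and bounds the product of [u - x n] with
    [b - beta^-1 p], for [b] in [B (x n)] (lemma [fitzpatrick_gap_ge]).

    The decrease is expressed with [w n], but the resolvent step of [B] alone
    shows that [d n <= 2 `|w n - u| ^+ 2] up to the same summable errors (lemma
    [penalty_step_le]).  Hence
      [(1 + gamma lambda n) d n <= d n.-1 + e n]
    with [e] summable and [lambda] not summable, which forces [d] to tend to
    [0] (lemma [quasi_fejer_cvg0]).  Since [x] converges to every zero [u], the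
    zero is unique. *)

(** * Series with terms indexed by the positive integers *)

Lemma is_cvg_series_bounded (R : realType) (u : nat -> R) (N : nat) (M : R) :
  (forall n, (N <= n)%N -> 0 <= u n) ->
  (forall n, (N <= n)%N -> \sum_(N <= k < n) u k <= M) -> cvgn (series u).
Proof.
move=> u0 uM; rewrite -(is_cvg_series_restrict N).
apply: nondecreasing_is_cvgn.
  apply/nondecreasing_seqP => n; have [nN|Nn] := leqP N n.
    by rewrite /= big_nat_recr//= lerDl u0.
  by rewrite /= (big_geq (ltnW Nn)) (big_geq Nn).
exists (Num.max M 0) => _ [n _ <-].
have [nN|Nn] := leqP N n; first by rewrite le_max uM.
by rewrite /= (big_geq (ltnW Nn)) le_max lexx orbT.
Qed.

(** Assumptions on series concern the indices [n > 0] only, whereas [series]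
    starts at [0]; the value at [0] is arbitrary but, as a single finite term,
    does not affect convergence. *)
Lemma fine_series (R : realType) (f : nat -> \bar R) :
  (forall n, (0 < n)%N -> 0 <= f n)%E -> (\sum_(1 <= n <oo) f n < +oo)%E ->
  (forall n, (0 < n)%N -> f n \is a fin_num) /\ cvgn (series (fine \o f)).
Proof.
move=> f0 foo.
have fle n : (\sum_(1 <= k < n) f k <= \sum_(1 <= n <oo) f n)%E.
  by apply: nneseries_lim_ge => k k1 _; exact: f0.
have ffin n : (0 < n)%N -> f n \is a fin_num.
  move=> n0; rewrite ge0_fin_numE ?f0//; apply: le_lt_trans foo.
  apply: le_trans (fle n.+1); rewrite big_nat_recr//= leeDr//.
  by rewrite big_nat sume_ge0// => k /andP[k0 _]; exact: f0.
split=> //.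
apply: (@is_cvg_series_bounded _ _ 1 (fine (\sum_(1 <= n <oo) f n)%E)).
  by move=> n n0; rewrite /= fine_ge0// f0.
move=> n n1; rewrite -lee_fin -sumEFin fineK.
  apply: le_trans (fle n); rewrite big_nat [leRHS]big_nat lee_sum//.
  by move=> k /andP[k0 _]; rewrite /= fineK ?ffin.
rewrite ge0_fin_numE//; apply: le_trans (fle 1%N).
by rewrite big_geq.
Qed.

Lemma ell_series (R : realType) (p : nat) (u : nat -> R) :
  (forall n, (0 < n)%N -> 0 <= u n) ->
  ell p u <-> cvgn (series (fun n => u n ^+ p)).
Proof.
move=> u0.
have up n : (0 < n)%N -> (0 <= (u n ^+ p)%:E)%E.
  by move=> n0; rewrite lee_fin exprn_ge0 ?u0.
have -> : ell p u = (\sum_(1 <= n <oo) (u n ^+ p)%:E < +oo)%E :> Prop.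
  rewrite /ell /summable /=.
  rewrite (@eq_esum _ _ _ _ (fun n => (u n ^+ p)%:E)); last first.
    by move=> n n0 /=; rewrite ger0_norm ?exprn_ge0 ?u0.
  rewrite -(@nneseries_esum _ _ (fun n => 0 < n)%N)//.
  congr (is_true (_ < _)%E); congr (limn _).
  apply/funext => -[|n]; first by rewrite !big_geq.
  rewrite [LHS]big_ltn_cond//= [LHS]big_nat_cond [RHS]big_nat_cond.
  by apply: eq_bigl => -[].
split=> [foo|cu].
  have [_ ] := fine_series up foo.
  by congr (cvgn (series _)); apply/funext.
have [M _ Mu] := pinfty_ex_gt0 (cvg_seq_bounded cu).
apply: (@le_lt_trans _ _ (M + `|u 0%N ^+ p|)%:E); last exact: ltry.
apply: lime_le; first by apply: is_cvg_nneseries => n n0 _; exact: up.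
apply: nearW => -[|n]; rewrite sumEFin lee_fin.
  by rewrite big_geq// addr_ge0// (le_trans _ (Mu 0%N I)).
have /= := Mu n.+1 I; rewrite /series /= big_ltn// => /ler_normlP[_].
by have := ler_norm (- u 0%N ^+ p); rewrite normrN; lra.
Qed.

(** * A quasi-Fejer recursion *)

(** The sequence [V n], obtained from [d n] by removing the errors made so far,
    is eventually nonincreasing and bounded below, so that [d] converges.  If
    its limit [L] were positive, then [d n] would eventually exceed [L / 2], and
    telescoping [l n.+1 * d n.+1 <= V n - V n.+1] would make [series l]
    bounded. *)
Lemma quasi_fejer_cvg0 (R : realType) (d l e : nat -> R) :
  (forall n, 0 <= d n) -> (forall n, (0 < n)%N -> 0 <= l n) ->
  cvgn (series e) -> ~ cvgn (series l) ->
  (\forall n \near \oo, (1 + l n.+1) * d n.+1 <= d n + e n.+1) ->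
  d @ \oo --> (0 : R).
Proof.
move=> d0 l0 ce ncl [N _ step].
pose V n := d n - series e n.+1.
have VS n : (N <= n)%N -> V n.+1 <= V n - l n.+1 * d n.+1.
  move=> /step /=; rewrite /V [series e n.+2]seriesSr /=; lra.
have Vnear : forall n, (N <= n)%N -> V n.+1 <= V n.
  by move=> n Nn; apply: le_trans (VS _ Nn) _; rewrite gerBl mulr_ge0 ?l0.
have [m Vm] : exists m, forall n, m <= V n.
  have [M _ Me] := pinfty_ex_gt0 (cvg_seq_bounded ce).
  exists (- M) => n; have /= := Me n.+1 I; rewrite ler_norml => /andP[_ eM].
  by rewrite /V; have := d0 n; lra.
have cV : cvgn V.
  apply: (@near_nonincreasing_is_cvgn _ _ m); last exact: nearW.
  exists N => // n /= Nn k nk.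
  elim: k nk => [|k IHk]; first by rewrite leqn0 => /eqP ->.
  rewrite leq_eqVlt => /predU1P[->//|]; rewrite ltnS => nk.
  by apply: le_trans (Vnear _ (leq_trans Nn nk)) _; exact: IHk.
have dE : d = (fun n => V n + series e n.+1).
  by apply/funext => n; rewrite /V subrK.
have cd : d @ \oo --> limn V + limn (series e).
  by rewrite {1}dE; apply: cvgD => //; rewrite cvg_shiftS.
have L0 : 0 <= limn V + limn (series e).
  rewrite -(cvg_lim _ cd)//; apply: limr_ge; last exact: nearW.
  by apply/cvg_ex; exists (limn V + limn (series e)).
move: L0; rewrite le_eqVlt => /predU1P[->//|L0].
exfalso; apply: ncl.
have [K _ dK] : \forall n \near \oo, (limn V + limn (series e)) / 2 <= d n.
  by apply: (cvgr_ge _ cd); lra.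
set L := limn V + _ in L0 cd dK.
pose N' := maxn N K.
have tele n : (N' <= n)%N -> L / 2 * \sum_(N'.+1 <= k < n.+1) l k <= V N' - V n.
  elim: n => [|n IHn].
    by rewrite leqn0 => /eqP ->; rewrite big_geq// mulr0 subrr.
  rewrite leq_eqVlt => /predU1P[<-|]; first by rewrite big_geq// mulr0 subrr.
  rewrite ltnS => Nn; rewrite big_nat_recr//= mulrDr.
  move: (IHn Nn) (VS _ (leq_trans (leq_maxl _ _) Nn)).
  have := dK n.+1 (leqW (leq_trans (leq_maxr _ _) Nn)) => /=.
  have := l0 n.+1 isT.
  nra.
apply: (@is_cvg_series_bounded _ _ N'.+1 ((L / 2)^-1 * (V N' - m))).
  by move=> n Nn; apply: l0; apply: leq_trans Nn.
case=> // n Nn; rewrite -ler_pdivrMl ?invr_gt0 ?divr_gt0// invrK.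
by apply: le_trans (tele _ Nn) _; rewrite lerD2l lerN2.
Qed.

(** * One step of the algorithm *)

Section one_step.
Variables (R : realType) (H : completeNormedModType R) (ip : {dot H for idfun}).

Lemma ipC (x y : H) : ip x y = ip y x.
Proof. by have := hermC ip x y; rewrite expr0 mul1r. Qed.

Lemma ipDl (x y z : H) : ip (x + y) z = ip x z + ip y z.
Proof. exact: linearDl. Qed.

Lemma ipNl (x z : H) : ip (- x) z = - ip x z.
Proof. exact: linearNl. Qed.

Lemma ipZl k (x z : H) : ip (k *: x) z = k * ip x z.
Proof. exact: linearZl_LR. Qed.

Lemma ipDr (x y z : H) : ip z (x + y) = ip z x + ip z y.
Proof. by rewrite !(ipC z) ipDl. Qed.

Lemma ipNr (x z : H) : ip z (- x) = - ip z x.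
Proof. by rewrite !(ipC z) ipNl. Qed.

Lemma ipZr k (x z : H) : ip z (k *: x) = k * ip z x.
Proof. by rewrite !(ipC z) ipZl. Qed.

Definition ip_expand := (ipDl, ipDr, ipNl, ipNr, ipZl, ipZr).

Hypothesis hip : induces_norm ip.

(** Here [x'] is the previous iterate, [w] the forward-backward step for [D]
    and [A], with [d' = D x'] and [a'] in [A w], and [x] the penalty step, with
    [b] equal to [beta] times an element of [B x].  The difference of the two
    sides of the conclusion is a combination of the slacks in the three
    hypotheses plus the two squares [s1] and [s2], which absorb the products of
    [w - x] with [p] and of [x' - w] with [d' - d]. *)
Lemma fb_step (u x' w x a a' d d' p b : H) (l g eta gamma : R) : 0 < l ->
  x' = w + l *: (a' + d') -> w = x + l *: b ->
  a + d + p = 0 ->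
  gamma * `|w - u| ^+ 2 <= ip (w - u) (a' - a) ->
  eta * `|d' - d| ^+ 2 <= ip (x' - u) (d' - d) ->
  ip (u - x) (b - p) <= g ->
  `|x - u| ^+ 2 + 2 * l * gamma * `|w - u| ^+ 2 <=
    `|x' - u| ^+ 2 + 2 * l * g + l ^+ 2 * `|p| ^+ 2
    - l * (2 * eta - l) * `|d' - d| ^+ 2.
Proof.
move=> l0 x'E wE adp hA hD hB.
have aE : a = - d - p by apply/eqP; rewrite -opprD -addr_eq0 addrA adp.
have s1 : 0 <= ip (w - x - l *: p) (w - x - l *: p) by rewrite hip exprn_ge0.
have s2 : 0 <= ip (x' - w - l *: (d' - d)) (x' - w - l *: (d' - d)).
  by rewrite hip exprn_ge0.
rewrite -subr_ge0.
have -> : `|x' - u| ^+ 2 + 2 * l * g + l ^+ 2 * `|p| ^+ 2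
      - l * (2 * eta - l) * `|d' - d| ^+ 2
      - (`|x - u| ^+ 2 + 2 * l * gamma * `|w - u| ^+ 2) =
    2 * l * (ip (w - u) (a' - a) - gamma * `|w - u| ^+ 2)
    + 2 * l * (ip (x' - u) (d' - d) - eta * `|d' - d| ^+ 2)
    + 2 * l * (g - ip (u - x) (b - p))
    + ip (w - x - l *: p) (w - x - l *: p)
    + ip (x' - w - l *: (d' - d)) (x' - w - l *: (d' - d)).
  rewrite -!hip {}aE {}x'E {}wE !ip_expand.
  (* Orient every symmetric pair the same way, so that the identity becomes
     polynomial in the remaining products. *)
  rewrite ?(ipC x u) ?(ipC x d) ?(ipC x d') ?(ipC x b) ?(ipC x p) ?(ipC x a').
  rewrite ?(ipC u d) ?(ipC u d') ?(ipC u b) ?(ipC u p) ?(ipC u a').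
  rewrite ?(ipC d d') ?(ipC d b) ?(ipC d p) ?(ipC d a').
  rewrite ?(ipC d' b) ?(ipC d' p) ?(ipC d' a').
  rewrite ?(ipC b p) ?(ipC b a') ?(ipC p a').
  ring.
by rewrite !addr_ge0// mulr_ge0 ?subr_ge0// mulr_ge0// ltW.
Qed.

(** This transfers the decrease, which [fb_step] measures at [w], to the
    iterate [x]. *)
Lemma penalty_step_le (u w x p b : H) (l g : R) : 0 < l ->
  w = x + l *: b -> ip (u - x) (b - p) <= g ->
  `|x - u| ^+ 2 <= 2 * `|w - u| ^+ 2 + 2 * l * g + 2 * l ^+ 2 * `|p| ^+ 2.
Proof.
move=> l0 wE hB.
have s1 : 0 <= ip (w - x - l *: p) (w - x - l *: p) by rewrite hip exprn_ge0.
have s2 : 0 <= ip (w - u + l *: p) (w - u + l *: p) by rewrite hip exprn_ge0.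
rewrite -subr_ge0.
have -> : 2 * `|w - u| ^+ 2 + 2 * l * g + 2 * l ^+ 2 * `|p| ^+ 2
      - `|x - u| ^+ 2 =
  ip (w - x - l *: p) (w - x - l *: p) + ip (w - u + l *: p) (w - u + l *: p)
  + 2 * l * (g - ip (u - x) (b - p)).
  rewrite -!hip {}wE !ip_expand.
  rewrite ?(ipC x u) ?(ipC x b) ?(ipC x p) ?(ipC u b) ?(ipC u p) ?(ipC b p).
  ring.
by rewrite !addr_ge0// mulr_ge0 ?subr_ge0// mulr_ge0// ltW.
Qed.
End one_step.

(** * The Fitzpatrick gap of the penalty operator *)

Lemma normal_coneZ (R : realType) (H : completeNormedModType R)
    (ip : {dot H for idfun}) (C : set H) (u p : H) (k : R) :
  0 <= k -> normal_cone ip C u p -> normal_cone ip C u (k *: p).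
Proof.
move=> k0 [Cu pC]; split=> // z Cz.
by rewrite ipZl mulr_ge0_le0// pC.
Qed.

Lemma support_fun_normal (R : realType) (H : completeNormedModType R)
    (ip : {dot H for idfun}) (C : set H) (u q : H) :
  normal_cone ip C u q -> support_fun ip C q = (ip q u)%:E.
Proof.
move=> [Cu qC]; apply/eqP; rewrite eq_le; apply/andP; split.
  apply: ge_ereal_sup => _ [z Cz <-]; rewrite lee_fin -subr_le0.
  by rewrite -ipNr -ipDr qC.
by apply: ereal_sup_ubound; exists u.
Qed.

(** Since [u] attains the support function at [q], the gap is at least the
    Fitzpatrick function at [(u, q)] minus [ip q u], and each point of
    [graph B] bounds that from below. *)
Lemma fitzpatrick_gap_ge (R : realType) (H : completeNormedModType R)
    (ip : {dot H for idfun}) (B : H -> set H) (C : set H) (u q z v : H) :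
  normal_cone ip C u q -> B z v ->
  ((ip (u - z) (v - q))%:E <=
   ereal_sup [set fitzpatrick ip B t q | t in C] - support_fun ip C q)%E.
Proof.
move=> Nu Bzv; rewrite (support_fun_normal Nu) leeBrDr//.
apply: (@le_trans _ _ (fitzpatrick ip B u q)); last first.
  by apply: ereal_sup_ubound; exists u => //; case: Nu.
apply: (@le_trans _ _ (ip u v + ip z q - ip z v)%:E); last first.
  by apply: ereal_sup_ubound; exists (z, v).
by rewrite -EFinD lee_fin !ip_expand (ipC ip q u); lra.
Qed.

(** * Convergence *)

Lemma fb_penalty_cvg (R : realType) (H : completeNormedModType R)
    (ip : {dot H for idfun}) (hip : induces_norm ip)
    (A B : H -> set H) (D : H -> H) (eta : R) (eta_gt0 : 0 < eta)
    (hD : cocoercive ip eta D) (C : set H) (hC : C = zer B)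
    (lambda beta : nat -> R)
    (lambda_gt0 : forall n, (0 < n)%N -> 0 < lambda n)
    (beta_gt0 : forall n, (0 < n)%N -> 0 < beta n)
    (hsum : forall p : H, ran (normal_cone ip C) p ->
      (\sum_(1 <= n <oo) (lambda n * beta n)%:E *
         (ereal_sup [set fitzpatrick ip B u ((beta n)^-1 *: p) | u in C]
          - support_fun ip C ((beta n)^-1 *: p)) < +oo)%E)
    (hlambda : (ell 2 `\` ell 1) lambda)
    (x y w : nat -> H)
    (hy : forall n, (0 < n)%N -> y n.-1 = x n.-1 - lambda n *: D (x n.-1))
    (hw : forall n, (0 < n)%N ->
      resolvent (op_scale (lambda n) A) (y n.-1) (w n))
    (hx : forall n, (0 < n)%N ->
      resolvent (op_scale (lambda n * beta n) B) (w n) (x n))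
    (gamma : R) (gamma_gt0 : 0 < gamma) (hAs : strongly_monotone ip gamma A)
    (u : H) :
  zer (op_add (op_add A (single D)) (normal_cone ip C)) u -> x @ \oo --> u.
Proof.
case=> _ [a Aua [_ -> <-]] [p Nup /eqP]; rewrite addr_eq0 => /eqP adp.
have {}adp : a + D u + p = 0 by rewrite adp addNr.
pose gap n := (ereal_sup [set fitzpatrick ip B t ((beta n)^-1 *: p) | t in C]
          - support_fun ip C ((beta n)^-1 *: p))%E.
pose f n := ((lambda n * beta n)%:E * gap n)%E.
have Nupn n : (0 < n)%N -> normal_cone ip C u ((beta n)^-1 *: p).
  by move=> n0; apply: normal_coneZ => //; rewrite invr_ge0 ltW// beta_gt0.
have Bu0 : B u 0 by case: Nup; rewrite hC.
have gap_ge0 n : (0 < n)%N -> (0 <= gap n)%E.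
  move=> n0; have := fitzpatrick_gap_ge (Nupn _ n0) Bu0.
  by rewrite subrr -(scale0r 0) ipZl mul0r.
have lb0 n : (0 < n)%N -> 0 < lambda n * beta n.
  by move=> n0; rewrite mulr_gt0 ?lambda_gt0 ?beta_gt0.
have [ffin fcvg] : (forall n, (0 < n)%N -> f n \is a fin_num) /\
    cvgn (series (fine \o f)).
  apply: fine_series; last by apply: hsum; exists u.
  by move=> n n0; rewrite mule_ge0 ?gap_ge0// lee_fin ltW ?lb0.
case: hlambda => l2 l1.
have l_ge0 n : (0 < n)%N -> 0 <= lambda n by move=> /lambda_gt0/ltW.
have cl2 : cvgn (series (fun n => lambda n ^+ 2)) by apply/(ell_series 2 l_ge0).
have gapfin n : (0 < n)%N -> gap n \is a fin_num.
  move=> n0; move: (ffin n n0) (gap_ge0 n n0); rewrite /f.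
  by case: (gap n) => [r| |]//; rewrite gt0_muley// lte_fin lb0.
have ncl : ~ cvgn (series (fun n => gamma * lambda n)).
  move=> cl; apply: l1; apply/(ell_series 1 l_ge0).
  have -> : (fun n => lambda n ^+ 1) = gamma^-1 *: (fun n => gamma * lambda n).
    apply/funext => n; change (lambda n ^+ 1 = gamma^-1 * (gamma * lambda n)).
    by rewrite expr1 mulKf// gt_eqF.
  exact: is_cvg_seriesZ.
pose P := `|p| ^+ 2.
(* The factor [1 + 2 * gamma] comes from adding [gamma * lambda n] times the
   bound of [penalty_step_le] to that of [fb_step], with [lambda n <= 1]. *)
pose e n := (1 + 2 * gamma) * (2 * fine (f n) + P * lambda n ^+ 2).
have ce : cvgn (series e).
  have -> : e = (1 + 2 * gamma) *:
      (2 *: (fine \o f) + P *: (fun n => lambda n ^+ 2)).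
    exact/funext.
  by apply: is_cvg_seriesZ; apply: is_cvg_seriesD; exact: is_cvg_seriesZ.
suff dcvg : (fun n => `|x n - u| ^+ 2) @ \oo --> (0 : R).
  apply/cvgrPdist_lt => r r0.
  have /cvgrPdist_lt/(_ (r ^+ 2)) := dcvg; rewrite exprn_gt0// => /(_ isT).
  apply: filterS => n; rewrite sub0r normrN ger0_norm ?exprn_ge0//.
  by rewrite ltr_pXn2r ?nnegrE ?(ltW r0)// distrC.
apply: (quasi_fejer_cvg0 _ _ ce ncl) => [n|n n0|].
- exact: exprn_ge0.
- by rewrite mulr_ge0 ?l_ge0// ltW.
have lsmall (r : R) : 0 < r -> \forall n \near \oo, lambda n.+1 < r.
  move=> r0; have /cvgrPdist_lt/(_ (r ^+ 2)) := cvg_series_cvg_0 cl2.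
  rewrite exprn_gt0// => /(_ isT) [N _ lN]; exists N => // n Nn.
  have := lN n.+1 (leqW Nn).
  rewrite /= sub0r normrN ger0_norm ?exprn_ge0 ?l_ge0//.
  by rewrite ltr_pXn2r ?nnegrE ?(ltW r0) ?l_ge0.
near=> n.
have ln0 := lambda_gt0 n.+1 isT; have bn0 := beta_gt0 n.+1 isT.
have l_1 : lambda n.+1 < 1 by near: n; apply: lsmall.
have l_eta : lambda n.+1 < 2 * eta by near: n; apply: lsmall; rewrite mulr_gt0.
have [_ -> [_ [a' Aw <-]] wE] := hw n.+1 isT.
have [_ -> [_ [b Bx <-]] xE] := hx n.+1 isT.
have step_b :
    ip (u - x n.+1) (beta n.+1 *: b - p) <= beta n.+1 * fine (gap n.+1).
  have := fitzpatrick_gap_ge (Nupn n.+1 isT) Bx.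
  rewrite -/(gap n.+1) -[gap n.+1 in leRHS]fineK ?gapfin// lee_fin.
  rewrite -(ler_pM2l bn0); apply: le_trans.
  by rewrite -ipZr scalerBr scalerA divff ?gt_eqF// scale1r.
have fE : lambda n.+1 * (beta n.+1 * fine (gap n.+1)) = fine (f n.+1).
  by rewrite /f fineM ?gapfin//= mulrA.
have xwE : w n.+1 = x n.+1 + lambda n.+1 *: (beta n.+1 *: b).
  by rewrite scalerA xE.
have x'E : x n = w n.+1 + lambda n.+1 *: (a' + D (x n)).
  by rewrite scalerDr addrA wE hy//= subrK.
have S1 := fb_step hip ln0 x'E xwE adp (hAs _ _ _ _ Aw Aua) (hD _ _) step_b.
have S2 := penalty_step_le hip ln0 xwE step_b.
have F0 : 0 <= fine (f n.+1).
  by rewrite fine_ge0// mule_ge0 ?gap_ge0// lee_fin ltW ?lb0.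
have P0 : 0 <= P by rewrite exprn_ge0.
move: S1 S2; rewrite -!(mulrA 2 (lambda _) (beta _ * _)) fE -/P.
rewrite /e => S1 S2.
have S1' : 0 <= lambda n.+1 * (2 * eta - lambda n.+1) * `|D (x n) - D u| ^+ 2.
  by rewrite mulr_ge0 ?exprn_ge0// mulr_ge0 ?subr_ge0 ?ltW.
have gl0 : 0 <= gamma * lambda n.+1 by rewrite mulr_ge0 ?ltW.
have S3 := ler_wpM2l gl0 S2.
have S4 : gamma * lambda n.+1 * (fine (f n.+1) + P * lambda n.+1 ^+ 2) <=
    gamma * (fine (f n.+1) + P * lambda n.+1 ^+ 2).
  apply: ler_wpM2r; first by rewrite addr_ge0// mulr_ge0// sqr_ge0.
  by rewrite ger_pMr// ltW.
have S5 : 0 <= gamma * fine (f n.+1) by rewrite mulr_ge0 ?(ltW gamma_gt0).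
lra.
Unshelve. all: end_near. Qed.

Theorem theorem2 (R : realType) (H : completeNormedModType R)
    (ip : {dot H for idfun}) (hip : induces_norm ip)
    (A B : H -> set H)
    (hA : maximally_monotone ip A) (hB : maximally_monotone ip B)
    (D : H -> H) (eta : R) (eta_gt0 : 0 < eta) (hD : cocoercive ip eta D)
    (C : set H) (hC : C = zer B) (C_neq0 : C !=set0)
    (lambda beta : nat -> R)
    (lambda_gt0 : forall n, (0 < n)%N -> 0 < lambda n)
    (beta_gt0 : forall n, (0 < n)%N -> 0 < beta n)
    (* (i) *)
    (hANC : maximally_monotone ip (op_add A (normal_cone ip C)))
    (hzer : zer (op_add (op_add A (single D)) (normal_cone ip C)) !=set0)
    (* (ii) *)
    (hsum : forall p : H, ran (normal_cone ip C) p ->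
      (\sum_(1 <= n <oo) (lambda n * beta n)%:E *
         (ereal_sup [set fitzpatrick ip B u ((beta n)^-1 *: p) | u in C]
          - support_fun ip C ((beta n)^-1 *: p)) < +oo)%E)
    (* (iii) *)
    (hlambda : (ell 2 `\` ell 1) lambda)
    (x0 : H) (x y w : nat -> H)
    (hx0 : x 0%N = x0)
    (hy : forall n, (0 < n)%N -> y n.-1 = x n.-1 - lambda n *: D (x n.-1))
    (hw : forall n, (0 < n)%N ->
      resolvent (op_scale (lambda n) A) (y n.-1) (w n))
    (hx : forall n, (0 < n)%N ->
      resolvent (op_scale (lambda n * beta n) B) (w n) (x n))
    (gamma : R) (gamma_gt0 : 0 < gamma) (hAs : strongly_monotone ip gamma A) :
  exists xbar : H,
    zer (op_add (op_add A (single D)) (normal_cone ip C)) = [set xbar] /\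
    x @ \oo --> xbar.
Proof.
have xcvg := fb_penalty_cvg hip eta_gt0 hD hC lambda_gt0 beta_gt0 hsum hlambda
  hy hw hx gamma_gt0 hAs.
have [u zu] := hzer; exists u; split; last exact: xcvg.
by apply/seteqP; split=> [v zv|_ ->//];
  exact: (cvg_unique _ (xcvg v zv) (xcvg u zu)).
Qed.
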